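(* Let $V\in\mathbb{R}_{\max}^{m\times d}$, let $F\in\mathbb{R}_{\max}^{d\times d}$ with $\lambda=\lambda(F)\neq-\infty$, and let $Z$ be a critical cycle of $F$ of length $l(Z)$. Consider the following two conditions. 1. For any $t_1\neq t_2$ (natural numbers), $V\otimes\lambda^{\otimes t_1}\otimes C_Z\otimes S_Z^{\otimes (t_1 \operatorname{rem} l(Z))}\neq V\otimes\lambda^{\otimes t_2}\otimes C_Z\otimes S_Z^{\otimes (t_2\operatorname{rem} l(Z))}$. 2. For no $t_1,t_2\geq (d-1)^2+1$ with $t_1\neq t_2$ is it the case that all columns of $V\otimes F^{\otimes t_1}$ with indices in $Z$ are equal to the corresponding columns of $V\otimes F^{\otimes t_2}$. Then conditions 1 and 2 are equivalent. Moreover, if either of them holds, then for any $A=V\otimes F^{\otimes t}$ with $t\geq (d-1)^2+1$, the procedure ''Part 2'' (described in the context), applied to $A,V,F$ and $Z$, returns this $t$, and this $t$ is unique.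
   Context: $\mathbb{R}_{\max}=\mathbb{R}\cup\{-\infty\}$ with $a\oplus b=\max(a,b)$, $a\otimes b=a+b$; matrix operations: $(A\oplus B)_{ij}=a_{ij}\oplus b_{ij}$, $(A\otimes B)_{ij}=\bigoplus_k a_{ik}\otimes b_{kj}$; $A^{\otimes t}$ is the $t$-th power with respect to $\otimes$, $A^{\otimes 0}=I$ (the tropical identity: $0$ on the diagonal, $-\infty$ off it). For a scalar $a\in\mathbb R$: $a^{\otimes t}=t a$ and $a^-=-a$; a scalar times a matrix ($\otimes$) adds the scalar to every entry. For $F\in\mathbb{R}_{\max}^{d\times d}$, $\mathcal{G}(F)$ is the weighted digraph on nodes $\{1,\dots,d\}$ with arcs $(i,j)$ such that $F_{ij}\neq-\infty$, with weight $F_{ij}$. $\lambda(F)$ is the maximum cycle mean: the maximum over all cycles of $\mathcal{G}(F)$ of (sum of arc weights)/(length), equal to $-\infty$ if there are no cycles. If $\lambda(F)\ne-\infty$, the critical graph $\mathcal{G}^c(F)$ is the subgraph consisting of all nodes and arcs of the cycles attaining $\lambda(F)$; a critical cycle is a cycle of $\mathcal{G}^c(F)$, and $l(Z)$ denotes the length of $Z$. For $B\in\mathbb{R}_{\max}^{d\times d}$, $B^+=B\oplus B^{\otimes 2}\oplus\dots\oplus B^{\otimes d}$. For a critical cycle $Z$ put $\lambda=\lambda(F)$, $U_Z=((\lambda^-\otimes F)^{\otimes l(Z)})^+$ and define $d\times d$ matrices $C_Z,S_Z,R_Z$: $(C_Z)_{ij}=(U_Z)_{ij}$ if $j$ is a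 node of $Z$ and $-\infty$ otherwise; $(R_Z)_{ij}=(U_Z)_{ij}$ if $i$ is a node of $Z$ and $-\infty$ otherwise; $(S_Z)_{ij}=\lambda^-\otimes F_{ij}$ if $(i,j)$ is an arc of $Z$ and $-\infty$ otherwise. $t\operatorname{rem}\sigma\in\{0,\dots,\sigma-1\}$ is the remainder of $t$ modulo $\sigma$. $X_{\cdot i}$ denotes the $i$-th column of $X$. Part 2 (the second stage of the algorithm for finding $t$ from $A=V\otimes F^{\otimes t}$): for $k=0,1,\dots,l(Z)-1$ in turn, check whether there is a real number $\mu$, the same for all nodes $i$ of $Z$, such that $A_{\cdot i}$ and $V\otimes (C_Z\otimes S_Z^{\otimes k}\otimes R_Z)_{\cdot i}$ differ by the constant $\mu$ (i.e. $A_{\cdot i}=\mu\otimes V\otimes (C_Z\otimes S_Z^{\otimes k}\otimes R_Z)_{\cdot i}$) for all nodes $i$ of $Z$, and such that $t=\mu/\lambda(F)$ is a natural number; return the first such $t$ that is found. *)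

(* Defs.v *)
From HB Require Import structures.
From mathcomp Require Import all_boot all_order all_algebra.
From mathcomp Require Import reals.

Set Implicit Arguments.
Unset Strict Implicit.
Unset Printing Implicit Defensive.
Import Order.TTheory GRing.Theory Num.Theory.
Local Open Scope ring_scope.

                                                                              
                                                                             
                                                                             
                                                                           
                                                   
Definition tropical (R : Type) : Type := option R.

HB.instance Definition _ (R : choiceType) :=
  Choice.copy (tropical R) (option R).

Section Tropical.
Variable R : realType.
Implicit Types x y z : tropical R.

Definition trop_add x y : tropical R :=
  match x, y with
  | Some a, Some b => Some (Num.max a b)
  | Some a, None => Some a
  | None, _ => y
  end.

Definition trop_mul x y : tropical R :=
  if x is Some a then if y is Some b then Some (a + b) else None else None.

Lemma trop_addA : associative trop_add.
Proof. by move=> [a|] [b|] [c|] //=; rewrite maxA. Qed.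

Lemma trop_addC : commutative trop_add.
Proof. by move=> [a|] [b|] //=; rewrite maxC. Qed.

Lemma trop_add0 : left_id None trop_add.
Proof. by case. Qed.

HB.instance Definition _ :=
  GRing.isNmodule.Build (tropical R) trop_addA trop_addC trop_add0.

Lemma trop_mulA : associative trop_mul.
Proof. by move=> [a|] [b|] [c|] //=; rewrite addrA. Qed.

Lemma trop_mulC : commutative trop_mul.
Proof. by move=> [a|] [b|] //=; rewrite addrC. Qed.

Lemma trop_mul1 : left_id (Some 0) trop_mul.
Proof. by case=> //= a; rewrite add0r. Qed.

Lemma trop_mulDl : left_distributive trop_mul trop_add.
Proof. by move=> [a|] [b|] [c|] //=; rewrite addr_maxl. Qed.

Lemma trop_mul0 : left_zero None trop_mul.
Proof. by []. Qed.

Lemma trop_oner_neq0 : Some 0 != 0 :> tropical R.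
Proof. by []. Qed.

HB.instance Definition _ :=
  GRing.Nmodule_isComNzSemiRing.Build (tropical R)
    trop_mulA trop_mulC trop_mul1 trop_mulDl trop_mul0 trop_oner_neq0.

Definition trop (a : R) : tropical R := Some a.

                                                           
Definition fin x : R := odflt 0 x.

                                               
Definition trop_inv x : tropical R := trop (- fin x).

End Tropical.

Section MaxPlus.
Variables (R : realType) (d : nat).
Implicit Types (F B : 'M[tropical R]_d) (Z : seq 'I_d) (e : rel 'I_d).

Definition arc F : rel 'I_d := fun i j => F i j != 0.

                                                                           
                                                        
Definition is_cycle e Z : bool := (Z != [::]) && ucycleb e Z.

Definition arc_of Z : rel 'I_d := fun i j => (i \in Z) && (next Z i == j).

Definition cycle_mean F Z : R :=
  (\sum_(i <- Z) fin (F i (next Z i))) / (size Z)%:R.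

                                                                           
                                                                             
Definition mcm F : tropical R :=
  \sum_(n < d) \sum_(c : n.+1.-tuple 'I_d | is_cycle (arc F) c)
    trop (cycle_mean F c).

                                 
Definition crit_arc F : rel 'I_d := fun i j =>
  [exists n : 'I_d, exists c : n.+1.-tuple 'I_d,
    [&& is_cycle (arc F) c, trop (cycle_mean F c) == mcm F & arc_of c i j]].

Definition critical_cycle F Z : bool := is_cycle (crit_arc F) Z.

Definition mxplus B : 'M[tropical R]_d := \sum_(1 <= k < d.+1) B ^+ k.

Definition U_mx F Z : 'M[tropical R]_d :=
  mxplus ((trop_inv (mcm F) *: F) ^+ size Z).

Definition C_mx F Z : 'M[tropical R]_d :=
  \matrix_(i, j) if j \in Z then U_mx F Z i j else 0.

Definition R_mx F Z : 'M[tropical R]_d :=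
  \matrix_(i, j) if i \in Z then U_mx F Z i j else 0.

Definition S_mx F Z : 'M[tropical R]_d :=
  \matrix_(i, j) if arc_of Z i j then trop_inv (mcm F) * F i j else 0.

                                                                               
                                                                            
                                                                            
Definition part2_test m (A V : 'M[tropical R]_(m, d)) F Z (k : nat)
    (mu : R) (t : nat) : Prop :=
  [/\ forall i, i \in Z ->
        col i A = trop mu *: (V *m col i (C_mx F Z *m S_mx F Z ^+ k *m R_mx F Z)),
      fin (mcm F) != 0
    & mu / fin (mcm F) = t%:R].

                                                                          
                                              
Definition part2_returns m (A V : 'M[tropical R]_(m, d)) F Z (t : nat) : Prop :=
  exists k : nat,
    [/\ (k < size Z)%N,
        exists mu : R, part2_test A V F Z k mu t
      & forall k' mu' t', (k' < k)%N -> ~ part2_test A V F Z k' mu' t'].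

End MaxPlus.

(* Main.v *)
Require Import Defs.
From HB Require Import structures.
From mathcomp Require Import all_boot all_order all_algebra.
From mathcomp Require Import reals boolp zify lra.

Set Implicit Arguments.
Unset Strict Implicit.
Unset Printing Implicit Defensive.
Import Order.TTheory GRing.Theory Num.Theory.
Local Open Scope ring_scope.

(** Normalise F to B = lambda^- F, so that closed walks of B weigh at most 0
    and Z weighs exactly 0.  The point is that for i in Z and
    t >= (d-1)^2 + 1, column i of B^t equals column i of C S^t and of C S^t R,
    i.e. every walk ending at i can be replaced by one that is no lighter, has
    the same length modulo l(Z), and has length less than
    (d-1)^2 + 1 + l(Z); copies of Z then fill it up to length t.  If l(Z) < d,
    it suffices to cut the walk wherever the pair (node, length mod l(Z))
    repeats.  If l(Z) = d, rescale so that the arcs of Z weigh 0 and all others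
    at most 0; up to moving along Z for free, a walk is a multiset of arcs
    with a prescribed sum of shifts in Z/dZ, from which zero-sum parts can be
    dropped.  What remains has at most d - 2 arcs, or d - 1 arcs of the same
    shift, and then the heaviest of them, repeated d - 1 times, does the job.

    The columns of V F^t in Z are thus lambda^t V C S^t for large t, and since
    S^l(Z) fixes V C, equalities between them can be translated in t by
    multiples of l(Z).  If Part 2 accepts t' at some k, then
    lambda^t' D = lambda^t D S^q with D = V C for some q; iterating l(Z) times
    gives lambda^(l t') D = lambda^(l t) D, so that t' = t, whatever k is. *)

(** * The order of the max-plus semiring *)

Section TropicalOrder.
Variable R : realType.
Implicit Types (x y z : tropical R).

Definition trop_le x y : bool := x + y == y.

Lemma trop_addxx x : x + x = x.
Proof. by case: x => [a|] //; congr Some; rewrite maxxx. Qed.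

Lemma trop_le_refl : reflexive trop_le.
Proof. by move=> x; rewrite /trop_le trop_addxx. Qed.

Lemma trop_le_anti : antisymmetric trop_le.
Proof. by move=> x y /andP[/eqP xy /eqP <-]; rewrite addrC. Qed.

Lemma trop_le_trans : transitive trop_le.
Proof. by move=> y x z /eqP xy /eqP yz; rewrite /trop_le -yz addrA xy. Qed.

HB.instance Definition _ := Order.Le_isPOrder.Build ring_display (tropical R)
  trop_le_refl trop_le_anti trop_le_trans.

End TropicalOrder.

(* A bare <= would make unification look for a structure joining order and
   semiring, of which MathComp has none. *)
Local Notation "x <<= y" := (@Order.le ring_display (tropical _) x y)
  (at level 70, no associativity).

Section TropicalOrderTheory.
Variable R : realType.
Implicit Types (x y z : tropical R) (a b : R).

Lemma tropleE x y : (x <<= y) = (x + y == y).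
Proof. by []. Qed.

Lemma trop_le_addP x y : reflect (x + y = y) (x <<= y).
Proof. exact: eqP. Qed.

Lemma trop0_le x : 0 <<= x.
Proof. by rewrite tropleE add0r. Qed.

Lemma trop_leD_le x y z : (x + y <<= z) = (x <<= z) && (y <<= z).
Proof.
apply/idP/andP => [xyz|[/trop_le_addP xz /trop_le_addP yz]].
  split; apply: le_trans xyz; first by rewrite tropleE addrA trop_addxx.
  by rewrite tropleE addrCA trop_addxx.
by rewrite tropleE -addrA yz xz.
Qed.

Lemma trop_leM x x' y y' : x <<= x' -> y <<= y' -> x * y <<= x' * y'.
Proof.
move=> /trop_le_addP <- /trop_le_addP <-.
by rewrite tropleE mulrDl mulrDr !addrA trop_addxx.
Qed.

Lemma trop_leM2l x y y' : y <<= y' -> x * y <<= x * y'.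
Proof. exact: trop_leM. Qed.

Lemma trop_leM2r x x' y : x <<= x' -> x * y <<= x' * y.
Proof. by move=> xx'; exact: trop_leM. Qed.

Lemma trop_le_total x y : (x <<= y) || (y <<= x).
Proof.
case: x => [a|]; last by rewrite trop0_le.
case: y => [b|]; last by rewrite trop0_le orbT.
by case: (leP a b) => ab; apply/orP; [left|right]; apply/eqP; congr Some;
  [apply: max_r | apply/max_r/ltW].
Qed.

Lemma trop_le_sum (I : Type) (r : seq I) (P : pred I) (F : I -> tropical R) y :
  (forall i, P i -> F i <<= y) -> \sum_(i <- r | P i) F i <<= y.
Proof.
move=> Fy; elim/big_rec: _ => [|i x Pi xy]; first exact: trop0_le.
by rewrite trop_leD_le Fy.
Qed.

Lemma trop_sum_ge_seq (I : eqType) (r : seq I) (P : pred I)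
    (F : I -> tropical R) i :
  i \in r -> P i -> F i <<= \sum_(j <- r | P j) F j.
Proof. by move=> ir Pi; rewrite (big_rem i) //= Pi tropleE addrA trop_addxx. Qed.

Lemma trop_sum_ge (I : finType) (P : pred I) (F : I -> tropical R) i :
  P i -> F i <<= \sum_(j | P j) F j.
Proof. exact/trop_sum_ge_seq/mem_index_enum. Qed.

Lemma trop_sum_attained (I : finType) (F : I -> tropical R) :
  \sum_i F i != 0 -> exists i, \sum_j F j = F i.
Proof.
elim/big_ind: _ => [|x y IHx IHy xy0|i _ _]; rewrite ?eqxx //; last by exists i.
have [yx|] := boolP (y <<= x).
  have e : x + y = x by rewrite addrC; apply/trop_le_addP.
  by rewrite e in xy0 *; exact: IHx.
move=> /negbTE yx; have := trop_le_total x y; rewrite yx orbF => /trop_le_addP e.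
by rewrite e in xy0 *; exact: IHy.
Qed.

Lemma trop_le_max (T : eqType) (f : T -> tropical R) (s : seq T) :
  s != [::] -> exists2 u, u \in s & {in s, forall v, f v <<= f u}.
Proof.
elim: s => // u [|v s] IHs _.
  by exists u; rewrite ?mem_head // => v; rewrite inE => /eqP ->.
have [//|w ws wmax] := IHs.
have /orP[uw|wu] := trop_le_total (f u) (f w).
  exists w; first by rewrite inE ws orbT.
  by move=> t; rewrite inE => /predU1P[-> //|/wmax].
exists u; first exact: mem_head.
by move=> t; rewrite inE => /predU1P[-> //|/wmax /le_trans]; apply.
Qed.

Lemma trop_mul_eq0 x y : (x * y == 0) = (x == 0) || (y == 0).
Proof. by case: x y => [a|] [b|]. Qed.

Lemma trop_leE a b : (trop a <<= trop b) = (a <= b).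
Proof.
rewrite tropleE; case: (leP a b) => ab.
  by apply/eqP; congr Some; exact: max_r.
apply/negbTE/eqP => -[]; rewrite max_l ?ltW // => e.
by rewrite e ltxx in ab.
Qed.

Lemma trop0E : trop 0 = 1 :> tropical R. Proof. by []. Qed.

Lemma trop_fin x : x != 0 -> trop (fin x) = x.
Proof. by case: x. Qed.

Lemma tropM a b : trop (a + b) = trop a * trop b :> tropical R.
Proof. by []. Qed.

Lemma trop_exp a n : trop a ^+ n = trop (a * n%:R) :> tropical R.
Proof.
elim: n => [|n IHn]; first by rewrite mulr0 expr0.
by rewrite exprS IHn -tropM -natr1 mulrDr mulr1 addrC.
Qed.

Lemma trop_prod (I : Type) (r : seq I) (F : I -> R) :
  \prod_(i <- r) trop (F i) = trop (\sum_(i <- r) F i) :> tropical R.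
Proof. by elim/big_rec2: _ => // i y1 y2 _ ->. Qed.

Lemma trop_le_prod (I : eqType) (r : seq I) (F G : I -> tropical R) :
  {in r, forall i, F i <<= G i} -> \prod_(i <- r) F i <<= \prod_(i <- r) G i.
Proof.
elim: r => [|i r IHr] FG; first by rewrite !big_nil.
rewrite !big_cons trop_leM ?FG ?mem_head ?IHr // => j jr.
by rewrite FG // inE jr orbT.
Qed.

End TropicalOrderTheory.

(** * Zero-sum sublists modulo d *)

Section ZeroSum.
Local Open Scope nat_scope.
Variables (T : eqType) (f : T -> nat) (d : nat).
Implicit Types s : seq T.

(** Taken up to permutation: the order of the jumps made later affects neither their weight nor,
    modulo d, the length of the walk. *)
Definition zero_sum s := exists s1 s2,
  [/\ perm_eq s (s1 ++ s2), s1 != [::] & d %| \sum_(x <- s1) f x].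

Lemma zero_sum_perm s s' : perm_eq s s' -> zero_sum s' -> zero_sum s.
Proof.
by move=> ss' [s1 [s2 [p ? ?]]]; exists s1, s2; split=> //; exact: perm_trans p.
Qed.

Lemma zero_sum_block s i j : i < j <= size s ->
  \sum_(x <- take i s) f x = \sum_(x <- take j s) f x %[mod d] -> zero_sum s.
Proof.
move=> /andP[ij js] e.
have tj : take j s = take i s ++ drop i (take j s).
  by rewrite -{1}(cat_take_drop i (take j s)) take_takel ?(ltnW ij).
exists (drop i (take j s)), (take i s ++ drop j s); split.
- by rewrite perm_sym perm_catCA catA -tj cat_take_drop.
- by rewrite -size_eq0 size_drop size_takel // subn_eq0 -ltnNge.
- move/eqP: e; rewrite {1}tj big_cat /=.
  by rewrite -{1}[\sum_(_ <- take i s) _]addn0 eqn_modDl mod0n eq_sym.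
Qed.

(** By [zero_sum_block] the [size s + 1] prefix sums are pairwise incongruent, and there are at
    least d of them, so they exhaust the residues. *)
Lemma not_zero_sum_surj s : 0 < d -> d <= (size s).+1 -> ~ zero_sum s ->
  size s < d /\ forall r, r < d ->
    exists2 i, i <= size s & r = (\sum_(x <- take i s) f x) %% d.
Proof.
move=> d0 ds nz.
pose L := [seq (\sum_(x <- take i s) f x) %% d | i <- iota 0 (size s).+1].
have sL : size L = (size s).+1 by rewrite size_map size_iota.
have nL i : i <= size s -> nth 0 L i = (\sum_(x <- take i s) f x) %% d.
  by move=> si; rewrite (nth_map 0) ?size_iota // nth_iota.
have uL : uniq L.
  apply: contraT => /(uniqPn 0) [i [j [ij]]]; rewrite sL ltnS => js.
  rewrite !nL // ?(leq_trans (ltnW ij)) // => e.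
  by case: nz; apply: (@zero_sum_block s i j); rewrite ?ij.
have LI : {subset L <= iota 0 d}.
  by move=> x /mapP[i _ ->]; rewrite mem_iota add0n ltn_mod.
split; first by have := uniq_leq_size uL LI; rewrite size_iota sL.
move=> r rd; have [|_ LE] := uniq_min_size uL LI; first by rewrite size_iota sL.
have : r \in L by rewrite LE mem_iota.
by move=> /(nthP 0)[i]; rewrite sL ltnS => si; rewrite nL // => <-; exists i.
Qed.

(* If x and y lie in s and s is listed as x, y, z1, z2, ..., the partial sums
   take all residues when no block sums to 0; whichever partial sum is
   congruent to f y, cancelling y exhibits a zero-sum sublist unless it is
   f x itself. *)
Lemma zero_sum_or_constant s : 0 < d -> d <= (size s).+1 ->
  zero_sum s \/
  (size s).+1 = d /\ {in s &, forall x y, f x = f y %[mod d]}.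
Proof.
move=> d0 ds; have [zs|nz] := EM (zero_sum s); first by left.
right; split.
  have [sd _] := not_zero_sum_surj d0 ds nz.
  by apply/eqP; rewrite eqn_leq ds sd.
move=> x y xs ys; apply/eqP/contraT => /eqP nxy.
have yx : y != x by apply: contra_notN nxy => /eqP ->.
pose K := rem y (rem x s).
have sK : perm_eq s (x :: y :: K).
  apply: (perm_trans (perm_to_rem xs)); rewrite perm_cons; apply: perm_to_rem.
  by move: ys; rewrite (perm_mem (perm_to_rem xs)) inE (negbTE yx).
have nzK : ~ zero_sum (x :: y :: K) by move=> /(zero_sum_perm sK).
rewrite (perm_size sK) in ds.
have [_ /(_ (f y %% d))[]] := not_zero_sum_surj d0 ds nzK.
  by rewrite ltn_mod.
move=> [|[|i]] si e.
- move: e; rewrite take0 big_nil mod0n => /eqP e.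
  case: nzK; exists [:: y], (x :: K).
  by rewrite big_seq1 /dvdn e -(perm_catCA [:: y] [:: x] K) perm_refl.
- by case: nxy; rewrite e big_seq1.
- case: nzK; exists (x :: take i K), (y :: drop i K); split=> //.
    rewrite /= perm_cons perm_sym (perm_catCA _ [:: y]) /= perm_cons.
    by rewrite cat_take_drop.
  move/eqP: e; rewrite /= !big_cons addnCA -{1}[f y]addn0 eqn_modDl mod0n.
  by rewrite eq_sym.
Qed.

End ZeroSum.

(** * Walks, elementary cycles and entries of powers *)

Local Notation "x <<= y" := (@Order.le ring_display (tropical _) x y)
  (at level 70, no associativity).

(** Lets a cycle be run through from any of its nodes, as the orbit of [next]. *)
Lemma cycle_traject (T : eqType) (c : seq T) x : uniq c -> x \in c ->
  perm_eq (traject (next c) x (size c)) c /\ iter (size c) (next c) x = x.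
Proof.
move=> uc xc; case: (rot_to xc) => i s' e.
have us : uniq (x :: s') by rewrite -e rot_uniq.
have ef : next (x :: s') =1 next c by rewrite -e; exact: next_rot.
have sc : size c = (size s').+1 by rewrite -(size_rot i) e.
have := cycle_next us; rewrite /= => /fpathE.
rewrite size_rcons => p.
have et n : iter n (next (x :: s')) x = iter n (next c) x.
  exact: eq_iter.
have tt y n : traject (next (x :: s')) y n = traject (next c) y n.
  by elim: n y => // n IHn y; rewrite !trajectS ef IHn.
split.
  suff -> : traject (next c) x (size c) = x :: s' by rewrite -e perm_rot.
  rewrite sc -tt trajectS; congr (_ :: _).
  have := congr1 (take (size s')) p.
  by rewrite -cats1 take_size_cat // take_traject.
by rewrite sc -et -[RHS](last_rcons x s' x) p last_traject.
Qed.

Section Walks.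
Variables (R : realType) (d : nat).
Implicit Types (B : 'M[tropical R]_d) (x y z : 'I_d) (s c : seq 'I_d).

(** Here s lists the nodes after the start x, so [size s] is the number of arcs. *)
Fixpoint wt B x s : tropical R :=
  if s is y :: s' then B x y * wt B y s' else 1.

Definition cwt B c : tropical R := \prod_(z <- c) B z (next c z).

Lemma wt_cat B x s1 s2 : wt B x (s1 ++ s2) = wt B x s1 * wt B (last x s1) s2.
Proof. by elim: s1 x => [|y s1 IHs] x /=; rewrite ?mul1r // IHs mulrA. Qed.

Lemma powS B n x y : (B ^+ n.+1) x y = \sum_z B x z * (B ^+ n) z y.
Proof. by rewrite exprS -[_ * _]/(_ *m _) mxE. Qed.

Lemma pow0 B x y : (B ^+ 0) x y = (x == y)%:R.
Proof. by rewrite expr0 mxE. Qed.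

Lemma wt_le_pow B x s : wt B x s <<= (B ^+ size s) x (last x s).
Proof.
elim: s x => [|y s IHs] x /=; first by rewrite pow0 eqxx.
rewrite powS; apply: le_trans (trop_leM2l _ (IHs y)) _.
exact: (trop_sum_ge (fun z => B x z * (B ^+ size s) z (last y s))).
Qed.

Lemma pow_wt B n x y : (B ^+ n) x y != 0 ->
  exists s, [/\ size s = n, last x s = y & (B ^+ n) x y = wt B x s].
Proof.
elim: n x => [|n IHn] x.
  rewrite pow0; case: (eqVneq x y) => [-> _|_]; last by rewrite eqxx.
  by exists [::].
rewrite powS => /[dup] nz /trop_sum_attained[z e].
rewrite e trop_mul_eq0 negb_or in nz; case/andP: nz => _ nz.
by have [s [? ? es]] := IHn z nz; exists (z :: s); split=> /=; rewrite ?e ?es; congruence.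
Qed.

Lemma powD_le B m n x y z :
  (B ^+ m) x y * (B ^+ n) y z <<= (B ^+ (m + n)) x z.
Proof.
rewrite exprD -[_ * _ in X in _ <<= X]/(_ *m _) mxE.
exact: (trop_sum_ge (fun y => (B ^+ m) x y * (B ^+ n) y z)).
Qed.

Lemma wt_traject B f x k :
  wt B x (traject f (f x) k) = \prod_(z <- traject f x k) B z (f z).
Proof. by elim: k x => [|k IHk] x /=; rewrite ?big_nil // big_cons IHk. Qed.

Lemma traject_le_pow B f x k :
  \prod_(z <- traject f x k) B z (f z) <<= (B ^+ k) x (iter k f x).
Proof.
rewrite -wt_traject -[X in B ^+ X](size_traject f (f x)) -last_traject.
exact: wt_le_pow.
Qed.

Lemma cwt_traject B c x : uniq c -> x \in c ->
  cwt B c = \prod_(z <- traject (next c) x (size c)) B z (next c z).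
Proof. by move=> uc xc; have [p _] := cycle_traject uc xc; rewrite (perm_big _ p). Qed.

Lemma cwt_le_pow B c x : uniq c -> x \in c -> cwt B c <<= (B ^+ size c) x x.
Proof.
move=> uc xc; rewrite (cwt_traject _ uc xc); have [_ e] := cycle_traject uc xc.
by rewrite -[X in _ <<= (B ^+ size c) x X]e traject_le_pow.
Qed.

(** Isolates the closed walk s2 between two visits to the same node; position i is the one reached
    after i arcs. *)
Lemma split_walk x s i j : (i <= j <= size s)%N ->
  nth x (x :: s) i = nth x (x :: s) j ->
  exists s1 s2 s3, [/\ s = s1 ++ s2 ++ s3, size s1 = i, size s2 = (j - i)%N
    & last (last x s1) s2 = last x s1].
Proof.
move=> /andP[ij js] e.
have lastt k : (k <= size s)%N -> last x (take k s) = nth x (x :: s) k.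
  move=> ks; rewrite (last_nth x) size_takel //.
  by case: k ks => //= k ks; rewrite nth_take.
have tj : take j s = take i s ++ drop i (take j s).
  by rewrite -{1}(cat_take_drop i (take j s)) take_takel.
exists (take i s), (drop i (take j s)), (drop j s); split.
- by rewrite catA -tj cat_take_drop.
- by rewrite size_takel // (leq_trans ij).
- by rewrite size_drop size_takel.
- by rewrite -last_cat -tj !lastt // (leq_trans ij).
Qed.

(** Induction on the length: a closed walk is an elementary cycle, or it splits at a repeated node
    into two shorter closed walks. *)
Lemma closed_wt_le1 B :
  (forall c, c != [::] -> uniq c -> cwt B c <<= 1) ->
  forall x s, last x s = x -> wt B x s <<= 1.
Proof.
move=> cB x s; have [n] := ubnP (size s); elim: n x s => // n IHn x s sn ls.
case/lastP: s sn ls => [|s' y] sn; first by [].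
rewrite last_rcons => yx; rewrite {y}yx in sn *.
have [us|] := boolP (uniq (rcons s' x)).
  have uc : uniq (x :: s') by move: us; rewrite rcons_uniq.
  have := cycle_next uc; rewrite /= => /fpathE; rewrite size_rcons => ->.
  rewrite wt_traject -[X in traject _ _ X]/(size (x :: s')).
  by rewrite -cwt_traject ?mem_head // cB.
move/(uniqPn x) => [i [j [ij js e]]].
(* [uniqPn] does not count the start node, [split_walk] does. The shift also makes s1 nonempty, so
   that s2 is shorter than the whole walk. *)
have [||s1 [s2 [s3 [es s1i s2j l2]]]] := @split_walk x (rcons s' x) i.+1 j.+1.
- by rewrite ltnS ltnW.
- exact: e.
have sz : size (rcons s' x) = (size s1 + (size s2 + size s3))%N.
  by rewrite es !size_cat.
have l3 : last (last x s1) s3 = x.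
  by rewrite -[RHS](last_rcons x s' x) es !last_cat l2.
rewrite es !wt_cat l2 mulrCA -[1]mulr1; apply: trop_leM.
  by apply: IHn => //; lia.
by rewrite -wt_cat; apply: IHn; rewrite ?last_cat // size_cat; lia.
Qed.

Lemma pow_diag_le1 B :
  (forall c, c != [::] -> uniq c -> cwt B c <<= 1) ->
  forall n x, (B ^+ n) x x <<= 1.
Proof.
move=> cB n x; have [->|/pow_wt[s [_ ls ->]]] := eqVneq ((B ^+ n) x x) 0.
  exact: trop0_le.
exact: closed_wt_le1.
Qed.

(** The more than d l positions of a long walk carry only d l pairs (node, length mod l). The closed
    walk between two equal pairs weighs at most 1, and removing it keeps the residue. *)
Lemma pow_reduce B l : (0 < l)%N -> (forall n x, (B ^+ n) x x <<= 1) ->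
  forall n x y, exists n', [/\ (n' < d * l)%N, n' = n %[mod l]
    & (B ^+ n) x y <<= (B ^+ n') x y].
Proof.
move=> l0 B1 n x y; have d0 : (0 < d)%N by apply: leq_ltn_trans (ltn_ord x).
elim/ltn_ind: n => n IHn.
have [nd|nd] := ltnP n (d * l); first by exists n.
have [->|/pow_wt[s [sn ls ->]]] := eqVneq ((B ^+ n) x y) 0.
  exists (n %% l)%N; rewrite modn_mod; split=> //; last exact: trop0_le.
  by rewrite (leq_trans (ltn_pmod n l0)) // leq_pmull.
pose f (i : 'I_n.+1) := (nth x (x :: s) i, Ordinal (ltn_pmod i l0)).
have /injectivePn[i [j ij eij]] : ~~ injectiveb f.
  apply/injectiveP => /leq_card; rewrite card_prod !card_ord; lia.
wlog lij : i j ij eij / (i < j)%N => [hw|].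
  have := ij; rewrite neq_ltn => /orP[|ji]; first exact: hw.
  by apply: hw (esym eij) ji; rewrite eq_sym.
case: eij => e1 e2.
have [||s1 [s2 [s3 [es s1i s2j l2]]]] := @split_walk x s i j.
- by rewrite sn (ltnW lij) -ltnS ltn_ord.
- exact: e1.
have sz : n = (size s1 + (size s2 + size s3))%N by rewrite -sn es !size_cat.
have [|n' [n'd en' le']] := IHn (size s1 + size s3)%N; first by lia.
exists n'; split=> //.
  rewrite en' sz s2j addnCA.
  apply/eqP; rewrite -[X in X == _ %[mod _]]add0n eqn_modDr mod0n eq_sym.
  by rewrite -/(dvdn _ _) -eqn_mod_dvd ?(ltnW lij) // e2.
apply: le_trans le'; rewrite es !wt_cat l2 mulrCA -[X in _ <<= X]mul1r.
apply: trop_leM.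
  by apply: le_trans (wt_le_pow _ _ _) _; rewrite l2; exact: B1.
have <- : last (last x s1) s3 = y by rewrite -ls es !last_cat l2.
by rewrite -wt_cat -last_cat -size_cat wt_le_pow.
Qed.

End Walks.

(** * Walks as jumps off a Hamiltonian cycle of weight-1 arcs *)

Section HamiltonianCycle.
Variables (R : realType) (d : nat) (B : 'M[tropical R]_d) (Z : seq 'I_d).
Hypotheses (Zuniq : uniq Z) (Zfull : forall x, x \in Z).
Hypotheses (BZ : forall x, B x (next Z x) = 1) (B_le1 : forall x y, B x y <<= 1).
Implicit Types (x y a b i j : 'I_d) (J : seq ('I_d * 'I_d)).

Definition cyc_dist a b : nat := index b (traject (next Z) a d).

(** An arc advances along Z by [cyc_dist] at the cost of one step, so the gain is [cyc_dist] minus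
    1; modulo d, adding [d.-1] avoids truncated subtraction. Arcs of Z have shift 0 modulo d. *)
Definition jump_shift (e : 'I_d * 'I_d) : nat := (cyc_dist e.1 e.2 + d.-1)%N.

(* Length of the walk from j to i that follows Z except for using the arcs
   of J, in this order. *)
Fixpoint jump_length j J i : nat :=
  if J is e :: J' then (cyc_dist j e.1 + 1 + jump_length e.2 J' i)%N
  else cyc_dist j i.

Fixpoint walk_arcs x s : seq ('I_d * 'I_d) :=
  if s is y :: s' then (x, y) :: walk_arcs y s' else [::].

Let size_Z : size Z = d.
Proof.
by rewrite -[RHS]card_ord cardE; apply/perm_size/uniq_perm;
  rewrite ?enum_uniq // => x; rewrite Zfull mem_enum.
Qed.

Lemma iter_next_mod x n : iter n (next Z) x = iter (n %% d) (next Z) x.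
Proof.
have [_ e] := cycle_traject Zuniq (Zfull x); rewrite size_Z in e.
rewrite {1}(divn_eq n d) addnC iterD; congr (iter _ _ _).
by elim: (n %/ d)%N => // k IHk; rewrite mulSn iterD IHk.
Qed.

Lemma cyc_dist_lt a b : (cyc_dist a b < d)%N.
Proof.
have [p _] := cycle_traject Zuniq (Zfull a); rewrite size_Z in p.
by rewrite -[X in (_ < X)%N](size_traject (next Z) a d) index_mem (perm_mem p).
Qed.

Lemma iter_cyc_dist a b : iter (cyc_dist a b) (next Z) a = b.
Proof.
have [p _] := cycle_traject Zuniq (Zfull a); rewrite size_Z in p.
rewrite -(@nth_traject _ (next Z) _ _ (cyc_dist_lt a b)) nth_index //.
by rewrite (perm_mem p).
Qed.

Lemma cyc_dist_iter a n : cyc_dist a (iter n (next Z) a) = (n %% d)%N.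
Proof.
have nd : (n %% d < d)%N by rewrite ltn_mod (leq_ltn_trans _ (ltn_ord a)).
have [p _] := cycle_traject Zuniq (Zfull a); rewrite size_Z in p.
rewrite iter_next_mod -(@nth_traject _ (next Z) _ _ nd) /cyc_dist index_uniq //.
  by rewrite size_traject.
by rewrite (perm_uniq p).
Qed.

Lemma cyc_distxx a : cyc_dist a a = 0%N.
Proof. by rewrite -{2}[a]/(iter 0 (next Z) a) cyc_dist_iter mod0n. Qed.

Lemma cyc_distD a b c : (cyc_dist a b + cyc_dist b c = cyc_dist a c %[mod d])%N.
Proof.
have -> : cyc_dist a c = cyc_dist a (iter (cyc_dist b c + cyc_dist a b) (next Z) a).
  by rewrite iterD !iter_cyc_dist.
by rewrite cyc_dist_iter modn_mod addnC.
Qed.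

Lemma cyc_dist_pow a b : 1 <<= (B ^+ cyc_dist a b) a b.
Proof.
have := traject_le_pow B (next Z) a (cyc_dist a b).
by rewrite iter_cyc_dist big1.
Qed.

(** The stretches along Z between the jumps are free. *)
Lemma jump_length_pow j J i :
  \prod_(e <- J) B e.1 e.2 <<= (B ^+ jump_length j J i) j i.
Proof.
elim: J j => [|[a b] J IHJ] j /=; first by rewrite big_nil cyc_dist_pow.
rewrite big_cons -[X in X <<= _]mul1r /= mulrA.
apply: le_trans (powD_le _ _ _ _ b _).
apply: trop_leM => //; apply: le_trans (powD_le _ _ _ _ a _).
by rewrite expr1 trop_leM ?cyc_dist_pow.
Qed.

(** Modulo d the length depends on J only through its total shift, which is why J may be permuted
    and zero-sum parts dropped. *)
Lemma jump_length_mod j J i :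
  (jump_length j J i + \sum_(e <- J) jump_shift e = cyc_dist j i %[mod d])%N.
Proof.
have d0 : (0 < d)%N by rewrite (leq_ltn_trans _ (ltn_ord j)).
elim: J j => [|[a b] J IHJ] j /=; first by rewrite big_nil addn0.
rewrite big_cons /jump_shift /=.
have -> : (cyc_dist j a + 1 + jump_length b J i +
    (cyc_dist a b + d.-1 + \sum_(e <- J) jump_shift e) =
  (cyc_dist j a + cyc_dist a b) +
    (jump_length b J i + \sum_(e <- J) jump_shift e) + d)%N by lia.
rewrite modnDr -modnDm IHJ cyc_distD modnDm.
exact: cyc_distD.
Qed.

Lemma jump_length_le j J i :
  (jump_length j J i <= size J + (size J).+1 * d.-1)%N.
Proof.
elim: J j => [|[a b] J IHJ] j /=; first by have := cyc_dist_lt j i; lia.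
by have := IHJ b; have := cyc_dist_lt j a; lia.
Qed.

(** The way back from b to a takes at most d - 2 steps, since d - 1 would make (a, b) an arc of Z.
    Each repetition of the jump thus costs at most d - 1. *)
Lemma jump_length_nseq j a b i k : ~~ (d %| jump_shift (a, b))%N ->
  (jump_length j (nseq k.+1 (a, b)) i <= k * d.-1 + d.-1 + d)%N.
Proof.
move=> nab; have ba : (cyc_dist b a < d.-1)%N.
  have lt := cyc_dist_lt b a; rewrite ltn_neqAle; apply/andP; split; last by lia.
  apply: contraNneq nab => e.
  by rewrite /dvdn /jump_shift /= -e cyc_distD cyc_distxx mod0n.
have IH k' : (jump_length b (nseq k' (a, b)) i <= k' * d.-1 + d.-1)%N.
  elim: k' => [|k' IHk] /=; first by have := cyc_dist_lt b i; lia.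
  by rewrite mulSn; lia.
by rewrite /=; have := IH k; have := cyc_dist_lt j a; lia.
Qed.

Lemma wt_walk_arcs x s : wt B x s = \prod_(e <- walk_arcs x s) B e.1 e.2.
Proof. by elim: s x => [|y s IHs] x /=; rewrite ?big_nil // big_cons IHs. Qed.

Lemma jump_length_walk_arcs x s : jump_length x (walk_arcs x s) (last x s) = size s.
Proof.
by elim: s x => [|y s IHs] x /=; rewrite cyc_distxx // IHs.
Qed.

Lemma jump_reduce J : exists J',
  [/\ \prod_(e <- J) B e.1 e.2 <<= \prod_(e <- J') B e.1 e.2,
      \sum_(e <- J) jump_shift e = \sum_(e <- J') jump_shift e %[mod d]
    & forall j i, (jump_length j J' i <= d * d.-1 + 1)%N].
Proof.
have [n] := ubnP (size J); elim: n J => // n IHn J Jn.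
(* Both cases meet the bound of [jump_length_le]; the empty J is listed apart because of d = 1. *)
have small : ((size J).+1 < d)%N \/ J = [::] -> forall j i,
    (jump_length j J i <= d * d.-1 + 1)%N.
  by move=> Js j i; have := jump_length_le j J i; case: Js => [|->/=]; nia.
have [Jd|Jd] := ltnP (size J).+1 d; first by exists J; split=> //; apply: small; left.
have [J0|J0] := eqVneq J [::]; first by exists J; split=> //; apply: small; right.
have [e0 _] : exists e, e \in J by case: (J) J0 => // e ? _; exists e; exact: mem_head.
have d0 : (0 < d)%N by rewrite (leq_ltn_trans _ (ltn_ord e0.1)).
have [[J1 [J2 [p J1n J1d]]]|nz] := EM (zero_sum jump_shift d J).
  have [|J' [w s l]] := IHn J2.
    move: Jn; rewrite (perm_size p) size_cat ltnS; apply: leq_trans.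
    by rewrite -add1n leq_add2r lt0n size_eq0.
  exists J'; split=> //.
    apply: le_trans w; rewrite (perm_big _ p) big_cat /= -[X in _ <<= X]mul1r.
    apply: trop_leM => //; apply: (big_ind (fun u => u <<= 1)) => // u v u1 v1.
    by rewrite -[1]mulr1 trop_leM.
  by rewrite (perm_big _ p) big_cat /= -modnDml (eqP J1d).
have [//|[Jd' Jc]] := zero_sum_or_constant jump_shift d0 Jd.
have [e eJ emax] := trop_le_max (fun e => B e.1 e.2) J0.
(* Otherwise e alone would be a zero-sum part. *)
have nze : ~~ (d %| jump_shift e)%N.
  apply/negP => ze; apply: nz; exists [:: e], (rem e J).
  by rewrite big_seq1; split=> //; exact: perm_to_rem.
exists (nseq (size J) e); split.
- apply: le_trans (trop_le_prod emax) _.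
  by rewrite big_const_seq count_predT big_nseq.
- rewrite big_nseq iter_addn_0 -[LHS]modn_summ.
  rewrite (eq_big_seq (fun=> jump_shift e %% d)%N); last first.
    by move=> e' e'J; exact: Jc.
  by rewrite modn_summ big_const_seq count_predT iter_addn_0.
move=> j i; case: e eJ emax nze => a b _ _ nze.
have [k Jk] : exists k, size J = k.+1.
  by case: (J) J0 => // ? J' _; exists (size J').
(* Here k + 1 = d - 1, so both sides equal (d-1)^2 + d. *)
have -> : (d * d.-1 + 1 = k * d.-1 + d.-1 + d)%N.
  by rewrite -Jd' Jk /=; lia.
by rewrite Jk; exact: jump_length_nseq.
Qed.

Lemma hamiltonian_reduce n x y : exists n',
  [/\ (n' <= d * d.-1 + 1)%N, n' = n %[mod d] & (B ^+ n) x y <<= (B ^+ n') x y].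
Proof.
have [->|/pow_wt[s [sn ls ->]]] := eqVneq ((B ^+ n) x y) 0.
  have d0 : (0 < d)%N by rewrite (leq_ltn_trans _ (ltn_ord x)).
  exists (n %% d)%N; rewrite modn_mod; split=> //; last exact: trop0_le.
  by have := ltn_pmod n d0; nia.
have [J [w e l]] := jump_reduce (walk_arcs x s).
exists (jump_length x J y); split=> //; last first.
  by rewrite wt_walk_arcs; apply: le_trans w (jump_length_pow _ _ _).
(* Both the original walk and the reduced one are jump walks from x to y, with congruent total
   shifts. *)
apply/eqP; rewrite -(eqn_modDr (\sum_(e <- J) jump_shift e)) jump_length_mod.
by rewrite -modnDmr -e modnDmr -sn -(jump_length_walk_arcs x) ls jump_length_mod.
Qed.

End HamiltonianCycle.

(** The potential p is the partial sum of w along Z from a base node; the zero total makes it close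
    up. *)
Lemma cycle_potential (R : realType) (T : eqType) (Z : seq T) (w : T -> R) :
  uniq Z -> \sum_(z <- Z) w z = 0 ->
  exists p : T -> R, {in Z, forall z, w z = p (next Z z) - p z}.
Proof.
case: Z => [|x Z'] uZ; first by exists (fun=> 0).
set Z := x :: Z' in uZ *; set f := next Z; set l := size Z => w0.
have [p e] := cycle_traject uZ (mem_head x Z'); rewrite -/Z -/f -/l in p e.
pose g n := \sum_(z <- traject f x n) w z.
have gS n : g n.+1 = g n + w (iter n f x) by rewrite /g trajectSr big_rcons.
have gl : g l = 0 by rewrite /g (perm_big _ p).
have uT : uniq (traject f x l) by rewrite (perm_uniq p).
pose q y := g (index y (traject f x l)).
have qE n : (n < l)%N -> q (iter n f x) = g n.
  by move=> nl; rewrite /q -(nth_traject f nl) index_uniq ?size_traject.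
exists q => z; rewrite -(perm_mem p) => /(nthP x)[n]; rewrite size_traject => nl.
rewrite nth_traject // => <-; rewrite -/(f _) -iterS [q (iter n f x)]qE //.
have [nl'|nl'] := ltnP n.+1 l; first by rewrite qE // gS addrC addKr.
have nlE : n.+1 = l by apply/eqP; rewrite eqn_leq nl.
have qx : q x = 0 by rewrite -[x]/(iter 0 f x) qE // /g big_nil.
rewrite nlE e qx sub0r.
by apply/eqP; rewrite -addr_eq0 addrC -gS nlE gl.
Qed.

(** * Reduction of walks modulo the length of a cycle of weight 1 *)

Section UnitCycle.
Variables (R : realType) (d : nat) (B : 'M[tropical R]_d) (Z : seq 'I_d).
Hypotheses (Bc : forall c, c != [::] -> uniq c -> cwt B c <<= 1).
Hypotheses (Zn : Z != [::]) (Zuniq : uniq Z) (Z1 : cwt B Z = 1).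
Implicit Types (x y i : 'I_d).

(** Diagonal similarity: the potentials of the inner nodes of a walk cancel. *)
Lemma pow_scale (p : 'I_d -> R) n x y :
  ((\matrix_(i, j) (trop (p i - p j) * B i j)) ^+ n) x y
    = trop (p x - p y) * (B ^+ n) x y.
Proof.
elim: n x => [|n IHn] x.
  rewrite !pow0; case: eqVneq => [->|]; first by rewrite subrr mul1r.
  by rewrite mulr0.
rewrite !powS mulr_sumr; apply: eq_bigr => z _.
rewrite mxE IHn mulrACA -tropM; congr (trop _ * _); lra.
Qed.

Let size_gt0 : (0 < size Z)%N.
Proof. by rewrite lt0n size_eq0. Qed.

Lemma cycle_pow_ge1 q i : i \in Z -> 1 <<= (B ^+ (size Z * q)) i i.
Proof.
move=> iZ; elim: q => [|q IHq]; first by rewrite muln0 pow0 eqxx.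
rewrite mulnS; apply: le_trans (powD_le _ _ _ _ i _); rewrite -[1]mulr1.
by apply: trop_leM => //; rewrite -Z1 cwt_le_pow.
Qed.

Lemma reduce_full n x y : size Z = d -> exists n',
  [/\ (n' <= d * d.-1 + 1)%N, n' = n %[mod d] & (B ^+ n) x y <<= (B ^+ n') x y].
Proof.
move=> Zd.
have Zfull z : z \in Z.
  have [||_ ->] := uniq_min_size (s2 := enum 'I_d) Zuniq; rewrite ?mem_enum //.
    by move=> t; rewrite mem_enum.
  by rewrite size_enum_ord Zd.
have nz z : B z (next Z z) != 0.
  have : cwt B Z != 0 by rewrite Z1.
  by rewrite /cwt (big_rem z) //= trop_mul_eq0 negb_or => /andP[].
have w0 : \sum_(z <- Z) fin (B z (next Z z)) = 0.
  suff: trop (\sum_(z <- Z) fin (B z (next Z z))) = 1 by case.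
  by rewrite -trop_prod -[RHS]Z1; apply: eq_bigr => z _; rewrite trop_fin.
have [p pw] := cycle_potential Zuniq w0.
pose B' := \matrix_(i, j) (trop (p i - p j) * B i j).
have powB' k a b : (B' ^+ k) a b = trop (p a - p b) * (B ^+ k) a b.
  exact: pow_scale.
have B'Z z : B' z (next Z z) = 1.
  by rewrite mxE -(trop_fin (nz z)) -tropM pw // addrA subrK subrr.
(* Closing the arc (a, b) by the free way along Z from b to a gives a closed walk, of weight at most
   1. *)
have B'1 a b : B' a b <<= 1.
  have := powD_le B' 1 (cyc_dist Z b a) a b a; rewrite expr1 (powB' _ a a).
  rewrite subrr mul1r.
  move=> /le_trans/(_ (pow_diag_le1 Bc _ _)); apply: le_trans.
  by rewrite -{1}[B' a b]mulr1 trop_leM // cyc_dist_pow.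
have [n' [n'l n'n le]] := hamiltonian_reduce Zuniq Zfull B'Z B'1 n x y.
exists n'; split=> //; move: le; rewrite !powB' => le.
have := trop_leM2l (trop (p y - p x)) le.
by rewrite !mulrA -!tropM addrA subrK subrr !mul1r.
Qed.

(** Source of the threshold: d(d-1) + 1 = (d-1)^2 + d if l(Z) = d, and otherwise d l(Z) <= (d-1)^2 +
    l(Z) because l(Z) <= d - 1. *)
Lemma reduce_bound n x y : exists n',
  [/\ (n' < (d - 1) ^ 2 + 1 + size Z)%N, n' = n %[mod size Z]
    & (B ^+ n) x y <<= (B ^+ n') x y].
Proof.
have Zd : (size Z <= d)%N.
  by rewrite -(card_uniqP Zuniq) -[X in (_ <= X)%N]card_ord max_card.
have [Ze|Zne] := eqVneq (size Z) d.
  have [n' [n'l n'n le]] := reduce_full n x y Ze.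
  by exists n'; rewrite Ze; split=> //; nia.
have [n' [n'l n'n le]] := pow_reduce size_gt0 (pow_diag_le1 Bc) n x y.
by exists n'; split=> //; nia.
Qed.

(** The reduced length n' is below t + l(Z) and congruent to t, hence at most t; laps of Z at i make
    up the difference. *)
Lemma critical_column_le n t x i : i \in Z -> ((d - 1) ^ 2 + 1 <= t)%N ->
  n = t %[mod size Z] -> (B ^+ n) x i <<= (B ^+ t) x i.
Proof.
move=> iZ td nt; have [n' [n'l n'n le]] := reduce_bound n x i.
have n't : (n' <= t)%N.
  rewrite leqNgt; apply/negP => tn'.
  have := eqn_mod_dvd (size Z) (ltnW tn'); rewrite n'n nt eqxx => /esym/dvdnP[q].
  by case: q => [|q]; nia.
have := eqn_mod_dvd (size Z) n't; rewrite n'n nt eqxx => /esym/dvdnP[q tq].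
apply: le_trans le _; rewrite -(subnKC n't) tq mulnC.
apply: le_trans (powD_le _ _ _ _ i _).
by rewrite -{1}[(B ^+ n') x i]mulr1 trop_leM // cycle_pow_ge1.
Qed.

End UnitCycle.

(** * Monotonicity and scaling of matrix products *)

Section MatrixOrder.
Variable R : realType.

Lemma trop_le_mulmx m n p (A A' : 'M[tropical R]_(m, n)) (D D' : 'M_(n, p)) :
  (forall i j, A i j <<= A' i j) -> (forall i j, D i j <<= D' i j) ->
  forall i j, (A *m D) i j <<= (A' *m D') i j.
Proof.
move=> AA' DD' i j; rewrite !mxE; apply: trop_le_sum => k _.
by apply: le_trans (trop_leM (AA' i k) (DD' k j)) _;
  exact: (trop_sum_ge (fun k => A' i k * D' k j)).
Qed.

Lemma trop_le_mxexp d (A A' : 'M[tropical R]_d) n :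
  (forall i j, A i j <<= A' i j) -> forall i j, (A ^+ n) i j <<= (A' ^+ n) i j.
Proof.
move=> AA'; elim: n => [|n IHn] i j; first by rewrite !expr0.
by rewrite !exprS; exact: trop_le_mulmx.
Qed.

Lemma mulmx_ge m n p (A : 'M[tropical R]_(m, n)) (D : 'M_(n, p)) i k j :
  A i k * D k j <<= (A *m D) i j.
Proof. by rewrite mxE; exact: (trop_sum_ge (fun k => A i k * D k j)). Qed.

Lemma expZ_mx d (a : tropical R) (A : 'M[tropical R]_d) n :
  (a *: A) ^+ n = a ^+ n *: A ^+ n.
Proof.
elim: n => [|n IHn]; first by rewrite !expr0 scale1r.
rewrite !exprS IHn -![_ * _ in LHS]/(_ *m _) -scalemxAl -scalemxAr scalerA.
by rewrite -exprS.
Qed.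

End MatrixOrder.

(** * Critical columns of large powers in terms of C, S and R *)

Section CSR.
Variables (R : realType) (d : nat) (F : 'M[tropical R]_d) (Z : seq 'I_d).
Let B := trop_inv (mcm F) *: F.
Hypotheses (Bc : forall c, c != [::] -> uniq c -> cwt B c <<= 1).
Hypotheses (Zn : Z != [::]) (Zuniq : uniq Z) (Z1 : cwt B Z = 1).
Implicit Types (x y i a : 'I_d).
Local Notation C := (C_mx F Z).
Local Notation S := (S_mx F Z).
Local Notation U := (U_mx F Z).
Local Notation RR := (R_mx F Z).
Local Notation l := (size Z).

Let l_gt0 : (0 < l)%N.
Proof. by rewrite lt0n size_eq0. Qed.

Lemma SE x y : S x y = if arc_of Z x y then B x y else 0.
Proof. by rewrite !mxE. Qed.

Lemma S_le x y : S x y <<= B x y.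
Proof. by rewrite SE; case: ifP => // _; exact: trop0_le. Qed.

Lemma UE x y : U x y = \sum_(1 <= k < d.+1) (B ^+ (l * k)) x y.
Proof. by rewrite summxE; apply: eq_bigr => k _; rewrite exprM. Qed.

Lemma U_pow x y : exists n, U x y <<= (B ^+ (l * n)) x y.
Proof.
have [->|] := eqVneq (U x y) 0; first by exists 0%N; exact: trop0_le.
rewrite UE big_add1 big_mkord => /trop_sum_attained[k ->].
by exists k.+1.
Qed.

Lemma pow_le_U n x a : a \in Z -> (l %| n)%N -> (B ^+ n) x a <<= U x a.
Proof.
move=> aZ ln; have [n' [n'l n'n le]] := pow_reduce l_gt0 (pow_diag_le1 Bc) n x a.
apply: le_trans le _.
have /dvdnP[k] : (l %| n')%N by rewrite /dvdn n'n -/(dvdn _ _).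
rewrite mulnC => n'E; rewrite {}n'E {n'n} in n'l *.
have kd : (k < d)%N by rewrite mulnC ltn_pmul2r in n'l.
case: k kd {n'l} => [|k] kd.
  (* The exponent 0 does not occur in U, so one lap of Z at a is added. *)
  apply: (@le_trans _ _ ((B ^+ (l * 1)) x a)).
    rewrite muln0; have := powD_le B 0 (l * 1) x a a; rewrite add0n.
    by apply: le_trans; rewrite -{1}[(B ^+ 0) x a]mulr1 trop_leM // cycle_pow_ge1.
  rewrite UE; apply: (trop_sum_ge_seq (fun k => (B ^+ (l * k)) x a)) => //.
  by rewrite mem_index_iota.
rewrite UE; apply: (trop_sum_ge_seq (fun k => (B ^+ (l * k)) x a)) => //.
by rewrite mem_index_iota; lia.
Qed.

Lemma S_pow_left_out k x y : x \notin Z -> (S ^+ k.+1) x y = 0.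
Proof.
move=> xZ; rewrite powS big1 // => z _.
by rewrite SE /arc_of (negbTE xZ) mul0r.
Qed.

Lemma S_pow_right_out k x y : y \notin Z -> (S ^+ k.+1) x y = 0.
Proof.
move=> yZ; rewrite exprSr -[_ * _]/(_ *m _) mxE big1 // => z _.
rewrite SE /arc_of; case: ifP; last by rewrite mulr0.
by move=> /andP[zZ /eqP e]; rewrite -e mem_next zZ in yZ.
Qed.

Lemma S_pow_iter k x y : (S ^+ k) x y != 0 -> y = iter k (next Z) x.
Proof.
elim: k x => [|k IHk] x.
  by rewrite pow0; case: (eqVneq x y) => [->//|_]; rewrite eqxx.
rewrite powS => /[dup] nz /trop_sum_attained[z e].
rewrite e trop_mul_eq0 negb_or in nz; case/andP: nz => nz1 nz2.
rewrite iterSr (IHk _ nz2); congr (iter _ _ _).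
by move: nz1; rewrite SE; case: ifP; rewrite ?eqxx // => /andP[_ /eqP].
Qed.

(** From a node of Z the only walk of S with l arcs is one lap, of weight 1. *)
Lemma S_pow_size x y : x \in Z -> (S ^+ l) x y = (x == y)%:R.
Proof.
move=> xZ; have [<-|xy] := eqVneq x y; last first.
  apply/eqP; apply: contraNT xy => /S_pow_iter ->.
  by have [_ ->] := cycle_traject Zuniq xZ.
rewrite [RHS]mulr1n; apply/le_anti/andP; split.
  exact: le_trans (trop_le_mxexp l S_le x x) (pow_diag_le1 Bc l x).
have <- : cwt S Z = 1.
  rewrite -Z1; apply: eq_big_seq => z zZ.
  by rewrite SE /arc_of zZ eqxx.
exact: cwt_le_pow.
Qed.

Lemma mul_S_pow_size m (M : 'M[tropical R]_(m, d)) q (x : 'I_m) i : i \in Z ->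
  (M *m S ^+ (l * q)) x i = M x i.
Proof.
move=> iZ; elim: q M => [|q IHq] M; first by rewrite muln0 expr0 mulmx1.
rewrite mulnS exprD -[_ * _]/(_ *m _) mulmxA IHq.
rewrite mxE (bigD1 i) //= S_pow_size // eqxx mulr1 big1 ?addr0 // => a ai.
have [aZ|aZ] := boolP (a \in Z); first by rewrite S_pow_size // (negbTE ai) mulr0.
by rewrite -(prednK l_gt0) S_pow_left_out // mulr0.
Qed.

Lemma CS_out k x i : i \notin Z -> (C *m S ^+ k) x i = 0.
Proof.
move=> iZ; rewrite mxE big1 // => a _.
case: k => [|k]; last by rewrite S_pow_right_out // mulr0.
rewrite pow0; have [->|] := eqVneq a i; last by rewrite mulr0.
by rewrite mxE (negbTE iZ) mul0r.
Qed.

Lemma C_mul_S_pow_size q : C *m S ^+ (l * q) = C.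
Proof.
apply/matrixP => x i; have [iZ|iZ] := boolP (i \in Z).
  exact: mul_S_pow_size.
by rewrite CS_out // mxE (negbTE iZ).
Qed.

Lemma C_mul_S_pow_mod k : C *m S ^+ (k %% l) = C *m S ^+ k.
Proof.
rewrite {2}(divn_eq k l) mulnC exprD -[_ * _]/(_ *m _) mulmxA.
by rewrite C_mul_S_pow_size.
Qed.

(** Every term is bounded by walks ending at i of length l n + k + l m, which is congruent to t. *)
Lemma CSR_le_pow k t x i : i \in Z -> ((d - 1) ^ 2 + 1 <= t)%N ->
  t = k %[mod l] -> (C *m S ^+ k *m RR) x i <<= (B ^+ t) x i.
Proof.
move=> iZ td tk.
have C_le a b : C a b <<= U a b.
  by rewrite mxE; case: ifP => // _; exact: trop0_le.
have R_le a b : RR a b <<= U a b.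
  by rewrite mxE; case: ifP => // _; exact: trop0_le.
rewrite mxE; apply: trop_le_sum => b _; rewrite mxE mulr_suml.
apply: trop_le_sum => a _.
have [n xa] := U_pow x a; have [m bi] := U_pow b i.
have le1 := trop_leM (le_trans (C_le x a) xa) (trop_le_mxexp k S_le a b).
apply: le_trans (trop_leM le1 (le_trans (R_le b i) bi)) _.
apply: le_trans (trop_leM2r _ (powD_le _ _ _ _ _ _)) _.
apply: le_trans (powD_le _ _ _ _ _ _) _.
have e : (l * n + k + l * m = t %[mod l])%N.
  by rewrite tk addnC mulnC modnMDl mulnC modnMDl.
exact: (critical_column_le Bc Zn Zuniq Z1 x iZ td e).
Qed.

(* Extended by r further steps along Z, with r + k divisible by the length of
   Z, a walk ending at i in Z becomes one that C accounts for; S ^+ k then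
   undoes these steps. *)
Lemma pow_le_CS k t x i : i \in Z -> t = k %[mod l] ->
  (B ^+ t) x i <<= (C *m S ^+ k) x i.
Proof.
move=> iZ tk; pose r := (l * k.+1 - k)%N.
have kr : (r + k = l * k.+1)%N by rewrite subnK //; nia.
have r0 : (0 < r)%N by rewrite subn_gt0; nia.
rewrite -(mul_S_pow_size _ k.+1 _ iZ) -kr exprD -[_ * _]/(_ *m _) mulmxA.
apply: trop_le_mulmx => // a b.
have [bZ|bZ] := boolP (b \in Z); last first.
  by rewrite mxE big1 ?trop0_le // => c _; rewrite -(prednK r0) S_pow_right_out ?mulr0.
apply: (@le_trans _ _ ((B ^+ (t + r)) a b)).
  rewrite exprD -[_ * _]/(_ *m _).
  by apply: trop_le_mulmx => // *; exact/trop_le_mxexp/S_le.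
rewrite mxE bZ; apply: pow_le_U => //.
by rewrite /dvdn -modnDml tk modnDml addnC kr modnMr.
Qed.

(** The diagonal of R is at least 1 on Z, thanks to the empty walk. *)
Lemma CS_le_CSR k x i : i \in Z ->
  (C *m S ^+ k) x i <<= (C *m S ^+ k *m RR) x i.
Proof.
move=> iZ; apply: le_trans (mulmx_ge _ _ x i i).
rewrite -{1}[(C *m S ^+ k) x i]mulr1 trop_leM // mxE iZ.
by apply: le_trans (pow_le_U i iZ (dvdn0 l)); rewrite pow0 eqxx.
Qed.

(** On column i the chain B^t <= C S^k <= C S^k R <= B^t closes. *)
Lemma CS_eq_pow k t x i : i \in Z -> ((d - 1) ^ 2 + 1 <= t)%N ->
  t = k %[mod l] -> (C *m S ^+ k) x i = (B ^+ t) x i.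
Proof.
move=> iZ td tk; apply/le_anti; rewrite pow_le_CS // andbT.
exact: le_trans (CS_le_CSR k x iZ) (CSR_le_pow _ _ _ _).
Qed.

Lemma CSR_eq_CS k x i : i \in Z ->
  (C *m S ^+ k *m RR) x i = (C *m S ^+ k) x i.
Proof.
move=> iZ; apply/le_anti; rewrite CS_le_CSR // andbT.
(* An auxiliary exponent past the threshold and congruent to k. *)
pose t := (((d - 1) ^ 2 + 1) * l + k)%N.
have td : ((d - 1) ^ 2 + 1 <= t)%N by rewrite /t; nia.
have tk : (t = k %[mod l])%N by rewrite /t modnMDl.
exact: le_trans (CSR_le_pow x iZ td tk) (pow_le_CS x iZ tk).
Qed.

End CSR.

(** * Cycle weights after normalisation by lambda *)

Section CriticalCycle.
Variables (R : realType) (d : nat) (F : 'M[tropical R]_d).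
Hypothesis hF : mcm F != 0.
Let B := trop_inv (mcm F) *: F.
Let lam := fin (mcm F).
Implicit Types (x y z : 'I_d) (c Z : seq 'I_d).

Lemma normE x y : B x y = trop (- lam) * F x y.
Proof. by rewrite mxE. Qed.

Lemma cycle_mean_le c : is_cycle (Defs.arc F) c -> trop (cycle_mean F c) <<= mcm F.
Proof.
move=> /[dup] cF /andP[]; case: c cF => // x c cF _ /andP[_ uc].
have cd : (size c < d)%N.
  by have := max_card (mem (x :: c)); rewrite card_ord (card_uniqP uc).
pose ct : (size c).+1.-tuple 'I_d := [tuple of x :: in_tuple c].
rewrite /mcm.
apply: le_trans (trop_sum_ge (P := xpredT)
  (fun n : 'I_d => \sum_(c : n.+1.-tuple 'I_d | is_cycle (Defs.arc F) c)
                     trop (cycle_mean F c)) (i := Ordinal cd) isT).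
exact: (trop_sum_ge (P := fun c : (size c).+1.-tuple 'I_d => is_cycle (Defs.arc F) c)
  (fun c : (size c).+1.-tuple 'I_d => trop (cycle_mean F c)) (i := ct)).
Qed.

Lemma cwt_norm c : is_cycle (Defs.arc F) c ->
  cwt B c = trop ((cycle_mean F c - lam) * (size c)%:R).
Proof.
move=> /andP[cn /andP[cc uc]].
have c0 : (size c)%:R != 0 :> R by rewrite pnatr_eq0 size_eq0.
rewrite mulrBl divfK // /cwt.
rewrite (eq_big_seq (fun z => trop (fin (F z (next c z)) - lam))); last first.
  move=> z zc; rewrite normE -{1}(trop_fin (next_cycle cc zc)) -tropM addrC //.
by rewrite trop_prod sumrB big_const_seq count_predT iter_addr_0 mulr_natr.
Qed.

Lemma cwt_norm_le1 c : c != [::] -> uniq c -> cwt B c <<= 1.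
Proof.
move=> cn uc; have [cF|ncF] := boolP (is_cycle (Defs.arc F) c).
  rewrite cwt_norm // -trop0E trop_leE mulr_le0_ge0 // subr_le0.
  by rewrite -trop_leE trop_fin // cycle_mean_le.
have [z zc Fz] : exists2 z, z \in c & F z (next c z) = 0.
  apply: contrapT => nz; case/negP: ncF; rewrite /is_cycle cn /ucycleb uc andbT.
  apply: cycle_from_next => // z zc; apply/negP => /eqP Fz.
  by apply: nz; exists z.
by rewrite /cwt (big_rem z) //= normE Fz mulr0 mul0r trop0_le.
Qed.

Lemma crit_arc_return x y : crit_arc F x y ->
  exists n, 1 <<= B x y * (B ^+ n) y x.
Proof.
move=> /existsP[n /existsP[c /and3P[cF /eqP cm /andP[xc /eqP <-]]]].
have c1 : cwt B c = 1.
  by rewrite cwt_norm // /lam -cm /= subrr mul0r.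
have uc : uniq c by case/andP: cF => _ /andP[].
have [_ it] := cycle_traject uc xc.
have sc : size c = (size c).-1.+1 by rewrite size_tuple.
exists (size c).-1; rewrite -c1 (cwt_traject _ uc xc) sc trajectS big_cons.
rewrite trop_leM2l // -[X in (B ^+ _) _ X]it sc iterSr; exact: traject_le_pow.
Qed.

(** Z may mix arcs of several critical cycles. Each arc can be returned along the rest of its own
    critical cycle, the two weighing at least 1 together. The returns, in reverse order, form a
    closed walk of weight at most 1, so Z itself weighs at least 1. *)
Lemma cwt_critical Z : critical_cycle F Z -> cwt B Z = 1.
Proof.
move=> /andP[Zn /andP[cZ uZ]].
have [x xZ] : exists x, x \in Z.
  by case: (Z) Zn => // x ? _; exists x; exact: mem_head.
have [p it] := cycle_traject uZ xZ.
have ret k : exists n, 1 <<=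
    \prod_(z <- traject (next Z) x k) B z (next Z z)
      * (B ^+ n) (iter k (next Z) x) x.
  elim: k => [|k [n IHk]]; first by exists 0%N; rewrite big_nil mul1r pow0 eqxx.
  have yZ : iter k (next Z) x \in Z.
    by elim: (k) => //= j; rewrite mem_next.
  have [m le] := crit_arc_return (next_cycle cZ yZ).
  exists (m + n)%N; rewrite trajectSr big_rcons.
  have := trop_leM IHk le; rewrite mulr1 mulrACA => /le_trans; apply.
  by apply: trop_leM => //; rewrite mulrC powD_le.
apply/le_anti; rewrite cwt_norm_le1 //=.
have [n] := ret (size Z); rewrite it -cwt_traject // => /le_trans; apply.
rewrite -{2}[cwt B Z]mulr1 trop_leM2l //.
exact/pow_diag_le1/cwt_norm_le1.
Qed.

End CriticalCycle.

(** * Equivalence of the conditions and correctness of Part 2 *)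

Theorem theorem2p11 (R : realType) (m d : nat)
    (V : 'M[tropical R]_(m, d)) (F : 'M[tropical R]_d) (Z : seq 'I_d)
    (hF : mcm F != 0) (hZ : critical_cycle F Z) :
  let cond1 := forall t1 t2 : nat, t1 <> t2 ->
    V *m (mcm F ^+ t1 *: C_mx F Z) *m S_mx F Z ^+ (t1 %% size Z)
    <> V *m (mcm F ^+ t2 *: C_mx F Z) *m S_mx F Z ^+ (t2 %% size Z) in
  let cond2 := forall t1 t2 : nat,
    ((d - 1) ^ 2 + 1 <= t1)%N -> ((d - 1) ^ 2 + 1 <= t2)%N -> t1 <> t2 ->
    ~ (forall i, i \in Z -> col i (V *m F ^+ t1) = col i (V *m F ^+ t2)) in
  (cond1 <-> cond2) /\
  (cond1 \/ cond2 ->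
   forall (A : 'M[tropical R]_(m, d)) (t : nat),
     ((d - 1) ^ 2 + 1 <= t)%N -> A = V *m F ^+ t ->
     [/\ forall t', part2_returns A V F Z t' <-> t' = t,
         forall k mu t', (k < size Z)%N -> part2_test A V F Z k mu t' -> t' = t
       & forall t', A = V *m F ^+ t' -> t' = t]).
Proof.
move=> cond1 cond2.
have [Zn /andP[_ Zuniq]] := andP hZ.
pose B := trop_inv (mcm F) *: F.
have Bc := cwt_norm_le1 hF; have Z1 := cwt_critical hF hZ.
have l0 : (0 < size Z)%N by rewrite lt0n size_eq0.
set l := size Z in l0 cond1 *; set C := C_mx F Z in cond1 *.
set S := S_mx F Z in cond1 *.
have mcmV : mcm F * trop_inv (mcm F) = 1.
  by rewrite -{1}(trop_fin hF) -tropM subrr.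
have FB t : F ^+ t = mcm F ^+ t *: B ^+ t.
  by rewrite -expZ_mx scalerA mcmV scale1r.
pose D := V *m C.
have DE t1 t2 : V *m (mcm F ^+ t1 *: C) *m S ^+ t2 = mcm F ^+ t1 *: (D *m S ^+ t2).
  by rewrite -scalemxAr -scalemxAl.
have D_mod t : D *m S ^+ (t %% l) = D *m S ^+ t.
  by rewrite -!mulmxA (C_mul_S_pow_mod Bc Zn Zuniq Z1).
(* Columns outside Z vanish, so equality on the columns in Z is equality of matrices. *)
have scaleD_out a k x i : i \notin Z -> (a *: (D *m S ^+ k)) x i = 0.
  move=> iZ; rewrite mxE -mulmxA mxE big1 ?mulr0 // => b _.
  by rewrite CS_out ?mulr0.
have VF t k i : i \in Z -> ((d - 1) ^ 2 + 1 <= t)%N -> t = k %[mod l] ->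
    forall x, (V *m F ^+ t) x i = (mcm F ^+ t *: (D *m S ^+ k)) x i.
  move=> iZ td tk x; rewrite FB -scalemxAr -mulmxA !mxE.
  congr (_ * _); apply: eq_bigr => a _; congr (_ * _).
  by rewrite (CS_eq_pow Bc Zn Zuniq Z1 a iZ td tk).
have colE (M N : 'M[tropical R]_(m, d)) i :
    (col i M = col i N) <-> forall x, M x i = N x i.
  split=> [/colP MN x|MN]; first by have := MN x; rewrite !mxE.
  by apply/colP => x; rewrite !mxE.
have VF_eq t1 t2 : ((d - 1) ^ 2 + 1 <= t1)%N -> ((d - 1) ^ 2 + 1 <= t2)%N ->
    (forall i, i \in Z -> col i (V *m F ^+ t1) = col i (V *m F ^+ t2)) <->
    mcm F ^+ t1 *: (D *m S ^+ t1) = mcm F ^+ t2 *: (D *m S ^+ t2).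
  move=> td1 td2; split=> [e|e i iZ].
    apply/matrixP => x i; have [iZ|iZ] := boolP (i \in Z).
      by rewrite -!VF //; have /colE := e i iZ.
    by rewrite !scaleD_out.
  by apply/colE => x; rewrite (VF t1 t1) // (VF t2 t2) // e.
have DS N : D *m S ^+ (l * N) = D.
  by rewrite -mulmxA (C_mul_S_pow_size Bc Zn Zuniq Z1).
have cond12 : cond1 <-> cond2.
  split=> [c1 t1 t2 td1 td2 t12|c2 t1 t2 t12].
    move=> /(VF_eq _ _ td1 td2) e; apply: (c1 _ _ t12).
    by rewrite !DE !D_mod.
  rewrite !DE !D_mod => e.
  (* N is past the threshold and a multiple of l, so shifting both exponents by N only scales both
     sides by lambda^N. *)
  pose N := (l * ((d - 1) ^ 2 + 1))%N.
  have Nd : ((d - 1) ^ 2 + 1 <= N)%N by rewrite /N; nia.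
  apply: (c2 (N + t1)%N (N + t2)%N); [lia..|].
  apply/VF_eq; [lia..|].
  have shift t : mcm F ^+ (N + t) *: (D *m S ^+ (N + t))
      = mcm F ^+ N *: (mcm F ^+ t *: (D *m S ^+ t)).
    by rewrite scalerA -exprD (exprD S) -[_ ^+ N * _]/(_ *m _) mulmxA DS.
  by rewrite !shift e.
split=> // c12; have c1 : cond1 by case: c12 => // /cond12.
have c2 : cond2 by apply/cond12.
move=> A t td At.
(* With lambda = 0 the exponents 0 and l would violate condition 1. *)
have lam0 : fin (mcm F) != 0.
  apply/negP => /eqP lam0; have m1 : mcm F = 1 by rewrite -(trop_fin hF) lam0.
  apply: (c1 0%N l); first by lia.
  by rewrite !DE m1 !expr1n mod0n modnn.
have lamX t' mu : mu / fin (mcm F) = t'%:R -> trop mu = mcm F ^+ t'.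
  move=> e; rewrite -{1}(trop_fin hF) trop_exp -e mulrC divfK //.
have testE k mu t' : mu / fin (mcm F) = t'%:R ->
    (forall i, i \in Z -> col i A =
      trop mu *: (V *m col i (C *m S ^+ k *m R_mx F Z))) <->
    mcm F ^+ t *: (D *m S ^+ t) = mcm F ^+ t' *: (D *m S ^+ k).
  move=> /lamX ->.
  have rhsE i x : i \in Z ->
      (mcm F ^+ t' *: (V *m col i (C *m S ^+ k *m R_mx F Z))) x 0
      = (mcm F ^+ t' *: (D *m S ^+ k)) x i.
    move=> iZ; rewrite /D -(mulmxA V) !mxE; congr (_ * _).
    apply: eq_bigr => a _; congr (_ * _); rewrite [LHS]mxE.
    by rewrite (CSR_eq_CS Bc Zn Zuniq Z1).
  split=> [e|e i iZ].
    apply/matrixP => x i; have [iZ|iZ] := boolP (i \in Z).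
      by rewrite -VF // -At -rhsE // -(e i iZ) mxE.
    by rewrite !scaleD_out.
  by apply/colP => x; rewrite rhsE // -e -VF // -At mxE.
have uniq_t k mu t' : part2_test A V F Z k mu t' -> t' = t.
  move=> [e _ /testE]; move=> /(_ k)[/(_ e) {}e _].
  apply: contrapT => t't.
  (* Multiplying by S^(l(k+1) - k) completes S^k to full laps and removes it from the right-hand
     side. *)
  pose q := (t + (l * k.+1 - k))%N.
  have e1 : mcm F ^+ t *: (D *m S ^+ q) = mcm F ^+ t' *: D.
    rewrite /q exprD -[_ * _]/(_ *m _) mulmxA scalemxAl e -scalemxAl -mulmxA.
    rewrite -[_ *m (S ^+ _)]/(_ * _) -exprD subnKC ?DS //; nia.
  have en n : (mcm F ^+ t) ^+ n *: (D *m S ^+ (q * n)) = (mcm F ^+ t') ^+ n *: D.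
    elim: n => [|n IHn]; first by rewrite muln0 !expr0 mulmx1.
    rewrite mulnSr exprD -[_ ^+ (q * n) * _]/(_ *m _) mulmxA exprS -scalerA.
    by rewrite scalemxAl IHn -scalemxAl scalerA mulrC -scalerA e1 scalerA -exprSr.
  (* For n = l the remaining power of S consists of full laps too, and both exponents have remainder
     0. *)
  apply: (c1 (t' * l)%N (t * l)%N); first by nia.
  rewrite !DE !modnMl expr0 mulmx1 !exprM -en.
  by rewrite mulnC DS.
split=> [t'|k mu t' _|t' At']; last 2 first.
- exact: uniq_t.
(* Here t' may lie below the threshold; multiplying by F^N lifts both exponents past it. *)
- apply: contrapT => t't; pose N := ((d - 1) ^ 2 + 1)%N.
  apply: (c2 (t' + N)%N (t + N)%N); [rewrite /N; lia..|] => i _.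
  by rewrite !exprD -![_ * _]/(_ *m _) !mulmxA -At -At'.
split=> [[k [_ [mu /uniq_t //]]]|{t'}->].
have test0 : part2_test A V F Z (t %% l) (fin (mcm F) * t%:R) t.
  have mut : fin (mcm F) * t%:R / fin (mcm F) = t%:R by rewrite mulrC mulKf.
  by split=> //; apply/(testE _ _ _ mut); rewrite D_mod.
have ex : exists k, `[< exists mu t', part2_test A V F Z k mu t' >].
  by exists (t %% l)%N; apply/asboolP; exists (fin (mcm F) * t%:R), t.
(* Part 2 stops at the least accepting k, perhaps before t rem l, but [uniq_t] shows that it returns
   t there too. *)
case: (ex_minnP ex) => k /asboolP[mu [t' test]] kmin.
exists k; split.
- apply: leq_ltn_trans (ltn_pmod t l0); apply: kmin; apply/asboolP.
  by exists (fin (mcm F) * t%:R), t.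
- by exists mu; rewrite -(uniq_t _ _ _ test).
- move=> k' mu' t'' k'k test'; move: k'k; rewrite ltnNge => /negP; apply.
  by apply: kmin; apply/asboolP; exists mu', t''.
Qed.
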